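(* Let $X$ be a topological space, $\mathcal V\subset\mathfrak V(X)$ and $\Upsilon,\Psi\in\mathfrak U(X)$. If $\mathcal V$ is a monolithic family, then $$BM(X,\mathcal V)\sim BM(X,\mathcal V;\Upsilon,\Psi)\qquad\text{and}\qquad MB(X,\mathcal V)\sim MB(X,\mathcal V;\Upsilon,\Psi).$$
   Context: Let $\mathcal T$ be the topology of $X$, $\mathcal T^*=\mathcal T\setminus\{\varnothing\}$, $\omega=\{0,1,2,\dots\}$. $\mathfrak V(X)$ is the set of all sequences $(V_n)_{n\in\omega}$ of members of $\mathcal T^*$ with $V_{n+1}\subset V_n$ for all $n$. $\mathfrak U(X)$ is the set of all maps $\Upsilon$ assigning to each $U\in\mathcal T^*$ a $\pi$-base $\Upsilon(U)$ of $U$, i.e. a family of nonempty open subsets of $U$ such that every nonempty open subset of $U$ contains a member of the family. $\Upsilon_t(X)\in\mathfrak U(X)$ is the map $U\mapsto\{V\in\mathcal T^*:V\subset U\}$. A family $\mathcal V\subset\mathfrak V(X)$ is monolithic if: whenever $(U_n)\in\mathfrak V(X)$, $(V_n)\in\mathcal V$ and $U_{n+1}\subset V_n\subset U_n$ for all $n\in\omega$, then $(U_n)\in\mathcal V$. Games $BM(X,\mathcal V;\Upsilon,\Psi)$ and $MB(X,\mathcal V;\Upsilon,\Psi)$: there are two players $\alpha,\beta$. On move $0$, $\alpha$ plays $U_0=X$ in the game $BM$, and $U_0\in\Upsilon(X)$ in the game $MB$; then $\beta$ chooses $V_0\in\Psi(U_0)$. On move $n\ge1$, $\alpha$ chooses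 $U_n\in\Upsilon(V_{n-1})$ and then $\beta$ chooses $V_n\in\Psi(U_n)$. Player $\alpha$ wins if $(V_n)_{n\in\omega}\in\mathcal V$; otherwise $\beta$ wins. Strategies may depend on all previous moves. Put $BM(X,\mathcal V)=BM(X,\mathcal V;\Upsilon_t(X),\Upsilon_t(X))$ and $MB(X,\mathcal V)=MB(X,\mathcal V;\Upsilon_t(X),\Upsilon_t(X))$. A game is $\kappa$-favorable if player $\kappa$ has a winning strategy in it. $G_1\sim G_2$ means that for each $\kappa\in\{\alpha,\beta\}$, $G_1$ is $\kappa$-favorable if and only if $G_2$ is $\kappa$-favorable. *)

(* Defs.v *)
From mathcomp Require Import all_boot.
From mathcomp Require Import boolp classical_sets topology.

Set Implicit Arguments.
Unset Strict Implicit.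
Unset Printing Implicit Defensive.

Local Open Scope classical_set_scope.

Record neopen (X : topologicalType) := NEOpen {
  neopen_set :> set X;
  neopen_open : open neopen_set;
  neopen_nonempty : neopen_set !=set0
}.

Definition decreasing_seqs (X : topologicalType) : set (nat -> neopen X) :=
  [set V | forall n, V n.+1 `<=` V n].

Definition pi_base (X : topologicalType) (U : neopen X)
    (B : set (neopen X)) : Prop :=
  (forall V, B V -> V `<=` U) /\
  (forall W : neopen X, W `<=` U -> exists2 V, B V & V `<=` W).

Definition pi_base_maps (X : topologicalType) :
    set (neopen X -> set (neopen X)) :=
  [set Upsilon | forall U, pi_base U (Upsilon U)].

Definition Upsilon_t (X : topologicalType) (U : neopen X) : set (neopen X) :=
  [set V | V `<=` U].

Definition monolithic (X : topologicalType)
    (VV : set (nat -> neopen X)) : Prop :=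
  forall U V : nat -> neopen X, decreasing_seqs U -> VV V ->
    (forall n, U n.+1 `<=` V n /\ V n `<=` U n) -> VV U.

(* A round is the pair (U_n, V_n) of the moves of alpha and beta.
   [alpha_first] is the set of legal choices of U_0, [alpha_next V_(n-1)] that
   of U_n for n >= 1, and [beta_reply U_n] that of V_n; alpha wins a run iff
   (V_n)_n belongs to [alpha_wins]. *)
Record game (M : Type) := Game {
  alpha_first : set M;
  alpha_next : M -> set M;
  beta_reply : M -> set M;
  alpha_wins : set (nat -> M)
}.

Section Games.
Variables (M : Type) (G : game M).
Implicit Types (h : seq (M * M)) (r : nat -> M * M).

(* Histories list the completed rounds in chronological order. *)
Definition alpha_moves h : set M :=
  if h is x :: h' then alpha_next G (last x h').2 else alpha_first G.

Inductive legal : seq (M * M) -> Prop :=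
| legal_nil : legal [::]
| legal_rcons h U V : legal h -> alpha_moves h U -> beta_reply G U V ->
    legal (rcons h (U, V)).

Definition run r : Prop := forall n, legal (mkseq r n).

Definition alpha_winning (s : seq (M * M) -> M) : Prop :=
  (forall h, legal h -> alpha_moves h (s h)) /\
  (forall r, run r -> (forall n, (r n).1 = s (mkseq r n)) ->
    alpha_wins G (fun n => (r n).2)).

Definition beta_winning (t : seq (M * M) -> M -> M) : Prop :=
  (forall h U, legal h -> alpha_moves h U -> beta_reply G U (t h U)) /\
  (forall r, run r -> (forall n, (r n).2 = t (mkseq r n) (r n).1) ->
    ~ alpha_wins G (fun n => (r n).2)).

End Games.

Inductive player := Alpha | Beta.

Definition favorable (M : Type) (k : player) (G : game M) : Prop :=
  match k with
  | Alpha => exists s, alpha_winning G s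
  | Beta => exists t, beta_winning G t
  end.

Definition game_equiv (M : Type) (G1 G2 : game M) : Prop :=
  forall k, favorable k G1 <-> favorable k G2.

(* The whole space is a member of [neopen X] only when X is nonempty, hence it
   is referred to through an element whose underlying set is [setT]. *)
Definition BM_game (X : topologicalType) (VV : set (nat -> neopen X))
    (Upsilon Psi : neopen X -> set (neopen X)) : game (neopen X) :=
  Game [set U : neopen X | U = [set: X] :> set X] Upsilon Psi VV.

Definition MB_game (X : topologicalType) (VV : set (nat -> neopen X))
    (Upsilon Psi : neopen X -> set (neopen X)) : game (neopen X) :=
  Game [set U | exists2 W : neopen X, W = [set: X] :> set X & Upsilon W U]
    Upsilon Psi VV.

Definition BM (X : topologicalType) (VV : set (nat -> neopen X)) :=
  BM_game VV (@Upsilon_t X) (@Upsilon_t X).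

Definition MB (X : topologicalType) (VV : set (nat -> neopen X)) :=
  MB_game VV (@Upsilon_t X) (@Upsilon_t X).

(* Main.v *)
Require Import Defs.
From mathcomp Require Import all_boot.
From mathcomp Require Import boolp classical_sets topology.

(** The full game T (any nonempty open subset may be played) and the restricted
    game G (moves taken from pi-bases) are compared by letting a player of one
    of them run a shadow play of the other and copy moves across.

    The comparison is organised by the notion [simulation L G1 G2]: in linked
    positions every move U of alpha in G1 has a counterpart U' in G2 such that
    every reply V' to U' in G2 has a counterpart V replying to U in G1, with
    the two rounds linked again by L; and alpha wins in G2 whenever alpha wins
    a linked run of G1. Read forwards, this carries a winning strategy of alpha
    from G1 to G2 (the shadow play is in G1); read backwards, it carries a
    winning strategy of beta from G2 to G1 (the shadow play is in G2). So two
    simulations, one in each direction between T and G, give all four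
    implications of the equivalence.

    - From T to G, alpha shrinks U to a member U' of the pi-base inside U, and
      beta's reply is copied unchanged: both plays produce the same sequence of
      sets V_n.
    - From G to T, alpha's move U is copied, and beta's reply V' in T is shrunk
      to a member V of the pi-base of U. The next move of alpha lies inside V,
      hence V'_(n+1) is contained in V_n, which is contained in V'_n: this
      interlacing is exactly what a monolithic family is insensitive to.

    The two kinds of games differ only in the first move of alpha, so they are
    treated together, with an arbitrary set of first moves. *)

Set Implicit Arguments.
Unset Strict Implicit.
Unset Printing Implicit Defensive.

Local Open Scope classical_set_scope.

(** * Selecting moves *)

(** Strategies must be legal on every history, even on those in which their
    owner did not follow them; there the shadow play makes no sense and any
    legal move will do. Hence moves are selected in a set of legal moves, with
    a preference for a smaller set that may be empty. *)
Lemma preferred_choice (I T : Type) (A B : I -> set T) :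
  (forall i, B i `<=` A i) -> (forall i, A i !=set0) ->
  exists f : I -> T, forall i, A i (f i) /\ (B i !=set0 -> B i (f i)).
Proof.
move=> BA A0.
suff /choice[f fP] : forall i, exists x, A i x /\ (B i !=set0 -> B i x).
  by exists f.
move=> i; have [[b Bb]|B0] := pselect (B i !=set0).
  by exists b; split=> //; exact: BA.
by have [a Aa] := A0 i; exists a.
Qed.

(** * Legal histories and shadow plays *)

Section Runs.
Variables (M : Type) (G : game M).
Implicit Types (h : seq (M * M)) (r : nat -> M * M).

Lemma alpha_moves_rcons h x : alpha_moves G (rcons h x) = alpha_next G x.2.
Proof. by case: h => [|y h] //=; rewrite last_rcons. Qed.

Lemma legal_rcons_inv h x : legal G (rcons h x) ->
  alpha_moves G h x.1 /\ beta_reply G x.1 x.2.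
Proof.
move E : (rcons h x) => k lk; case: lk E => [|h' U V _ hU UV]; first by case: h.
by move=> /rcons_inj[-> ->].
Qed.

Lemma run_reply r n : run G r -> beta_reply G (r n).1 (r n).2.
Proof.
by move=> /(_ n.+1); rewrite mkseqS => /legal_rcons_inv[].
Qed.

Lemma run_next r n : run G r -> alpha_next G (r n).2 (r n.+1).1.
Proof.
move=> /(_ n.+2); rewrite mkseqS => /legal_rcons_inv[+ _].
by rewrite mkseqS alpha_moves_rcons.
Qed.

Definition never_blocked : Prop :=
  (forall V, alpha_next G V !=set0) /\ (forall U, beta_reply G U !=set0).

End Runs.

(** The shadow of a history: each round [x] is translated by [step], which sees
    the shadow of the earlier rounds. *)
Definition shadow (M : Type) (step : seq (M * M) -> M * M -> M * M) :=
  foldl (fun h x => rcons h (step h x)) [::].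

Lemma shadow_mkseq (M : Type) (step : seq (M * M) -> M * M -> M * M) r n :
  shadow step (mkseq r n) =
  mkseq (fun k => step (shadow step (mkseq r k)) (r k)) n.
Proof.
elim: n => // n IHn.
by rewrite [RHS]mkseqS -IHn mkseqS /shadow foldl_rcons.
Qed.

(** * Simulations between games *)

Section Simulation.
Variables (M : Type) (L : M * M -> M * M -> Prop) (G1 G2 : game M).

Definition linked_reply (U : M) (y : M * M) : set M :=
  [set V | beta_reply G1 U V /\ L (U, V) y].

Definition matching (U U' : M) : Prop :=
  forall V', beta_reply G2 U' V' -> linked_reply U (U', V') !=set0.

(** Unfolded, the order of the quantifiers is: for all U there is U' such that
    for all V' there is V. Moves of alpha are thus translated from G1 to G2 and
    moves of beta back from G2 to G1, so that either player can use it. *)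
Definition answers (A1 A2 : set M) : Prop :=
  forall U, A1 U -> exists2 U', A2 U' & matching U U'.

Record simulation : Prop := Simulation {
  sim_first : answers (alpha_first G1) (alpha_first G2);
  sim_next : forall x y, L x y ->
    answers (alpha_next G1 x.2) (alpha_next G2 y.2);
  sim_wins : forall r1 r2, run G1 r1 -> run G2 r2 ->
    (forall n, L (r1 n) (r2 n)) ->
    alpha_wins G1 (fun n => (r1 n).2) -> alpha_wins G2 (fun n => (r2 n).2)
}.

Hypothesis sim : simulation.

Lemma sim_moves r1 r2 n : (forall i, i < n -> L (r1 i) (r2 i)) ->
  answers (alpha_moves G1 (mkseq r1 n)) (alpha_moves G2 (mkseq r2 n)).
Proof.
case: n => [_|n Ln]; first exact: sim_first sim.
by rewrite !mkseqS !alpha_moves_rcons; apply: (sim_next sim); exact: Ln.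
Qed.

(** Alpha replies to beta's moves in G2 by feeding linked replies, in a shadow
    play of G1, to the given strategy [s], and answering [s] in G2. *)
Lemma sim_alpha : never_blocked G2 -> favorable Alpha G1 -> favorable Alpha G2.
Proof.
move=> [next0 _] [s [s_legal s_wins]].
have [c cP] := @preferred_choice (M * (M * M)) M (fun=> setT)
  (fun p => linked_reply p.1 p.2) (fun=> @subsetT _ _)
  (fun p => ex_intro _ p.1 I).
pose step h y := (s h, c (s h, y)).
pose good h := [set U' | alpha_moves G2 h U' /\
  matching (s (shadow step h)) U'].
(* The first move of [s] shows that alpha can open G2. *)
have first0 : alpha_first G2 !=set0.
  have [U' U'P _] := sim_first sim (s_legal _ (legal_nil G1)).
  by exists U'.
have moves0 h : alpha_moves G2 h !=set0 by case: h => [|x h] /=.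
have [|s' s'P] := preferred_choice (B := good) _ moves0.
  by move=> h U' [].
exists s'; split=> [h _|r2 run2 r2E]; first by have [] := s'P h.
pose r1 n := step (shadow step (mkseq r2 n)) (r2 n).
have shE n : shadow step (mkseq r2 n) = mkseq r1 n by exact: shadow_mkseq.
have r1E n : (r1 n).1 = s (mkseq r1 n) by rewrite -shE.
(* Legality of the shadow play and linkedness must be proved together: each
   translation is available only in a legal position linked to the real one. *)
have inv n : legal G1 (mkseq r1 n) /\ forall i, i < n -> L (r1 i) (r2 i).
  elim: n => [|n [l1 Ln]]; first by split=> //; exact: legal_nil.
  have [U' U'P mU'] := sim_moves Ln (s_legal _ l1).
  have [_ gP] := s'P (mkseq r2 n).
  have [_ ms'] : good (mkseq r2 n) (s' (mkseq r2 n)).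
    by apply: gP; exists U'; split=> //; rewrite shE.
  have [rep1 LUV] : linked_reply (s (mkseq r1 n)) (r2 n) (r1 n).2.
    rewrite /r1 /= shE; apply: (cP (_, _)).2 => /=.
    have := run_reply n run2; rewrite shE in ms'.
    by move=> /[dup]; rewrite {1}r2E => /ms'; rewrite -r2E -surjective_pairing.
  have r1nE : r1 n = (s (mkseq r1 n), (r1 n).2).
    by rewrite -r1E -surjective_pairing.
  rewrite -r1nE in LUV; split=> [|i].
    rewrite mkseqS r1nE; apply: legal_rcons => //; exact: s_legal.
  by rewrite ltnS leq_eqVlt => /orP[/eqP->|/Ln].
have run1 : run G1 r1 by move=> n; have [] := inv n.
apply: (sim_wins sim run1 run2) => [n|]; last exact: s_wins.
by have [_] := inv n.+1; apply.
Qed.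

(** The mirror image of the previous lemma: beta translates alpha's moves in G1
    into a shadow play of G2, where the given strategy [t] replies. *)
Lemma sim_beta : never_blocked G1 -> favorable Beta G2 -> favorable Beta G1.
Proof.
move=> [_ reply0] [t [t_legal t_wins]].
pose good h U := [set U' | alpha_moves G2 h U' /\ matching U U'].
have [a aP] := @preferred_choice (seq (M * M) * M) M (fun=> setT)
  (fun p => good p.1 p.2) (fun=> @subsetT _ _) (fun p => ex_intro _ p.2 I).
pose step h (x : M * M) := (a (h, x.1), t h (a (h, x.1))).
pose round h U := (a (shadow step h, U),
  t (shadow step h) (a (shadow step h, U))).
have [|t' t'P] := @preferred_choice (seq (M * M) * M) M
  (fun p => beta_reply G1 p.2)
  (fun p => linked_reply p.2 (round p.1 p.2)) _ (fun p => reply0 p.2).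
  by move=> p V [].
exists (fun h U => t' (h, U)); split=> [h U _ _|r1 run1 r1E].
  by have [] := t'P (h, U).
pose r2 n := round (mkseq r1 n) (r1 n).1.
have shE n : shadow step (mkseq r1 n) = mkseq r2 n by exact: shadow_mkseq.
have r2E n : (r2 n).2 = t (mkseq r2 n) (r2 n).1 by rewrite -shE.
have inv n : legal G2 (mkseq r2 n) /\ forall i, i < n -> L (r1 i) (r2 i).
  elim: n => [|n [l2 Ln]]; first by split=> //; exact: legal_nil.
  have move1 : alpha_moves G1 (mkseq r1 n) (r1 n).1.
    by have := run1 n.+1; rewrite mkseqS => /legal_rcons_inv[].
  have [U' U'P mU'] := sim_moves Ln move1.
  have [mv2 mtch] : good (mkseq r2 n) (r1 n).1 (r2 n).1.
    by rewrite /r2 /= shE; apply: (aP (_, _)).2; exists U'.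
  have rep2 : beta_reply G2 (r2 n).1 (r2 n).2.
    by rewrite r2E; exact: t_legal.
  have [_ LP] := t'P (mkseq r1 n, (r1 n).1).
  have [_] : linked_reply (r1 n).1 (r2 n) (t' (mkseq r1 n, (r1 n).1)).
    by apply: LP; have := mtch _ rep2; rewrite -surjective_pairing.
  rewrite -r1E -surjective_pairing => LUV; split=> [|i].
    by rewrite mkseqS [r2 n]surjective_pairing; exact: legal_rcons.
  by rewrite ltnS leq_eqVlt => /orP[/eqP->|/Ln].
have run2 : run G2 r2 by move=> n; have [] := inv n.
move=> /(sim_wins sim run1 run2) win; apply: (t_wins r2) => //; apply: win => n.
by have [_] := inv n.+1; apply.
Qed.

End Simulation.

Lemma simulation_equiv (M : Type) (L L' : M * M -> M * M -> Prop)
    (G1 G2 : game M) :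
  never_blocked G1 -> never_blocked G2 ->
  simulation L G1 G2 -> simulation L' G2 G1 -> game_equiv G1 G2.
Proof.
by move=> nb1 nb2 s12 s21 [] ; split;
  [exact: sim_alpha s12 _ | exact: sim_alpha s21 _
  |exact: sim_beta s21 _ | exact: sim_beta s12 _].
Qed.

(** * Games played in pi-bases *)

Section PiBases.
Variables (X : topologicalType) (VV : set (nat -> neopen X)).
Variables Upsilon Psi : neopen X -> set (neopen X).
Hypotheses (UpsilonP : @pi_base_maps X Upsilon) (PsiP : @pi_base_maps X Psi).

Lemma pi_base_maps_t : @pi_base_maps X (@Upsilon_t X).
Proof. by move=> U; split=> // W WU; exists W. Qed.

Lemma never_blocked_pi_base F : never_blocked (Game F Upsilon Psi VV).
Proof.
by split=> U /=; [have [_ /(_ U)] := UpsilonP U | have [_ /(_ U)] := PsiP U];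
  move=> /(_ (@subset_refl _ _))[V BV _]; exists V.
Qed.

Variables F F' : set (neopen X).

(** A smaller move of alpha only restricts beta, whose replies remain legal in
    the full game; so beta's sets, hence the outcomes, coincide. *)
Lemma simulation_to_pi_base :
  (forall U, F U -> exists2 U', F' U' & U' `<=` U) ->
  simulation (fun x y => x.2 = y.2)
    (Game F (@Upsilon_t X) (@Upsilon_t X) VV) (Game F' Upsilon Psi VV).
Proof.
move=> FF'.
have matchP (U U' : neopen X) : U' `<=` U ->
    matching (fun x y => x.2 = y.2)
      (Game F (@Upsilon_t X) (@Upsilon_t X) VV) (Game F' Upsilon Psi VV) U U'.
  move=> U'U V' /= PV'; exists V'; split=> //=.
  by apply: subset_trans U'U; exact: (PsiP U').1 PV'.
split=> [U /FF'[U' F'U' U'U]|[U0 V] [U0' V'] /= <- U UV|r1 r2 _ _ E /=].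
- by exists U' => //; exact: matchP.
- by have [U' YU' U'U] := (UpsilonP V).2 U UV; exists U' => //; exact: matchP.
- by under eq_fun do rewrite E.
Qed.

(** Here beta's replies differ, but alpha's moves are shared, and each of them
    lies between consecutive replies of the two plays. This forces the
    interlacing to which monolithicity applies. *)
Lemma simulation_from_pi_base : monolithic VV -> F' `<=` F ->
  simulation (fun x y : neopen X * neopen X => x.1 = y.1 /\ x.2 `<=` y.2)
    (Game F' Upsilon Psi VV) (Game F (@Upsilon_t X) (@Upsilon_t X) VV).
Proof.
move=> mono F'F.
have matchP U : matching (fun x y : neopen X * neopen X =>
      x.1 = y.1 /\ x.2 `<=` y.2)
    (Game F' Upsilon Psi VV) (Game F (@Upsilon_t X) (@Upsilon_t X) VV) U U.
  by move=> V' /= V'U; have [V PV VV'] := (PsiP U).2 V' V'U; exists V.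
split=> [U F'U|[U0 V] [U0' V'] /= [_ VV'] U YU|r1 r2 run1 run2 E /= win].
- by exists U => //; exact: F'F.
- by exists U => //; apply: subset_trans VV'; exact: (UpsilonP V).1 YU.
- have inter n : (r2 n.+1).2 `<=` (r1 n).2 /\ (r1 n).2 `<=` (r2 n).2.
    split; last exact: (E n).2.
    apply: subset_trans (run_reply n.+1 run2) _; rewrite -(E n.+1).1.
    exact: (UpsilonP _).1 (run_next n run1).
  by apply: (mono _ _ _ win inter) => n;
    exact: subset_trans (inter n).1 (inter n).2.
Qed.

End PiBases.

(** The sets of first moves are arbitrary up to refinement: both are the whole
    space alone in the games where the opening is forced, and in those where
    alpha chooses it, the second one is a pi-base of the space. *)
Lemma pi_base_game_equiv (X : topologicalType) (VV : set (nat -> neopen X))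
    (Upsilon Psi : neopen X -> set (neopen X)) (F F' : set (neopen X)) :
  @pi_base_maps X Upsilon -> @pi_base_maps X Psi -> monolithic VV ->
  (forall U, F U -> exists2 U', F' U' & U' `<=` U) -> F' `<=` F ->
  game_equiv (Game F (@Upsilon_t X) (@Upsilon_t X) VV)
    (Game F' Upsilon Psi VV).
Proof.
move=> UP PP mono FF' F'F; apply: simulation_equiv.
- by apply: never_blocked_pi_base; exact: pi_base_maps_t.
- exact: never_blocked_pi_base.
- exact: simulation_to_pi_base.
- exact: simulation_from_pi_base.
Qed.

Theorem proposition1 (X : topologicalType) (VV : set (nat -> neopen X))
    (Upsilon Psi : neopen X -> set (neopen X)) :
  VV `<=` @decreasing_seqs X ->
  @pi_base_maps X Upsilon -> @pi_base_maps X Psi ->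
  monolithic VV ->
  game_equiv (BM VV) (BM_game VV Upsilon Psi) /\
  game_equiv (MB VV) (MB_game VV Upsilon Psi).
Proof.
move=> _ UP PP mono; split; apply: pi_base_game_equiv => //.
- by move=> U UX; exists U.
- move=> U [W WX UW]; have [U' YU' U'U] := (UP W).2 U UW.
  by exists U' => //; exists W.
- by move=> U [W WX YU]; exists W => //; exact: (UP W).1 YU.
Qed.
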